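(* Consider an ELLC function $f_i:\mathcal Z\subset\mathbb R^{n_z}\to\mathbb R$ (the $i$-th component of the vector field of a discrete-time (DT) or continuous-time (CT) system) with known Clarke-derivative bounds $a_{ij},b_{ij}$, $j\in\mathbb N_{n_z}$. Then the tightest tractable (mixed-monotone) remainder-form upper and lower decomposition functions for $f_i$, with $z\ge\hat z$, are $$\overline f_{d,i}(z,\hat z)=\min_{\mathbf m\in\mathbf M_i^c}\ f_i(\zeta^+_{\mathbf m})+\mathbf m^\top(\zeta^-_{\mathbf m}-\zeta^+_{\mathbf m}),\qquad \underline f_{d,i}(\hat z,z)=\max_{\mathbf m\in\mathbf M_i^c}\ f_i(\zeta^-_{\mathbf m})+\mathbf m^\top(\zeta^+_{\mathbf m}-\zeta^-_{\mathbf m}),$$ where $\zeta^+_{\mathbf m}=\zeta_{\mathbf m}(z,\hat z)$, $\zeta^-_{\mathbf m}=\zeta_{\mathbf m}(\hat z,z)$, and the finite set of supporting vectors $\mathbf M_i^c$ is $$\mathbf M_i^c=\{\mathbf m\in\mathbb R^{n_z}:\ \mathbf m_j=\max(b_{ij},0)\ \text{or}\ \mathbf m_j=\min(a_{ij},0),\ \forall j\in\mathbb N_{n_z}\}$$ in the DT case, and $$\mathbf M_i^c=\{\mathbf m\in\mathbb R^{n_z}:\ \mathbf m_j=\max(b_{ij},0)\ \text{or}\ \mathbf m_j=\min(a_{ij},0),\ \forall j\in\mathbb N_{n_z},\,j\ne i,\ \ \mathbf m_i=0\}$$ in the CT case. Here ''tightest'' is within the family of remainder-form decomposition functions $f_{d,i}(\cdot,\cdot;\mathbf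 m,h)$: for all $z\ge\hat z$ in $\mathcal Z$, $$\overline f_{d,i}(z,\hat z)=\min_{\mathbf m\in\mathbf M_i,\ h\in\mathcal H_{\mathbf M_i}} f_{d,i}(z,\hat z;\mathbf m,h),\qquad \underline f_{d,i}(\hat z,z)=\max_{\mathbf m\in\mathbf M_i,\ h\in\mathcal H_{\mathbf M_i}} f_{d,i}(\hat z,z;\mathbf m,h).$$ Moreover, the resulting inclusion function for an interval domain $\mathbb I\mathcal Z=[\underline z,\overline z]$ is called the remainder-form inclusion function $T_R^{f_{d,i}}=[\underline f_{d,i}(\underline z,\overline z),\overline f_{d,i}(\overline z,\underline z)]$.
   Context: Notation: $\mathbb N_n=\{1,\dots,n\}$; inequalities between vectors are componentwise; $[\underline z,\overline z]=\{z:\underline z\le z\le\overline z\}$. The system is $x_t^+=f(z_t)$ (a known input is suppressed), with $z_t=[x_t^\top\ w_t^\top]^\top\in\mathcal Z=\mathcal X\times\mathcal W\subset\mathbb R^{n_z}$, state $x_t\in\mathcal X\subset\mathbb R^{n_x}$, disturbance $w_t\in\mathcal W$, $f=(f_1,\dots,f_{n_x})$, where $x_t^+=x_{t+1}$ (DT) or $x_t^+=\dot x_t$ (CT). $x_i$ denotes the $i$-th state coordinate, i.e. the $i$-th coordinate of $z$. ELLC: $\varphi:\mathcal Z\to\mathbb R$ is either-sided locally Lipschitz continuous if for every $z\in\mathcal Z$ there are an open neighborhood $\mathcal N_z\subset\mathcal Z$ of $z$, a vector $\kappa\in\mathbb R^{n_z}$ with all entries nonzero, and $\rho\in\mathbb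 R$ such that $\langle\kappa(\varphi(z')-\varphi(z'')),z'-z''\rangle\le\rho\|z'-z''\|_2^2$ for all $z',z''\in\mathcal N_z$. Clarke derivatives: $(\overline J^{\varphi}_C(z))_j=\limsup_{t\to z,\lambda\downarrow0}\frac{\varphi(t+\lambda e_j)-\varphi(t)}{\lambda}$ and $(\underline J^{\varphi}_C(z))_j=\liminf_{t\to z,\lambda\downarrow0}\frac{\varphi(t+\lambda e_j)-\varphi(t)}{\lambda}$, with $e_j$ the $j$-th standard unit vector. Bounds: $a_{ij},b_{ij}\in\mathbb R\cup\{\pm\infty\}$ are known bounds on the Clarke derivatives of $f_i$, $a_{ij}\le(\underline J_C^{f_i}(z))_j$ and $(\overline J_C^{f_i}(z))_j\le b_{ij}$ for all $z\in\mathcal Z$, such that for each $j$, $b_{ij}<\infty$ or $a_{ij}>-\infty$. Supporting vectors: DT: $\mathbf M_i=\{\mathbf m\in\mathbb R^{n_z}:\forall j,\ \mathbf m_j\ge\max(b_{ij},0)\text{ or }\mathbf m_j\le\min(a_{ij},0)\}$. CT: the same with the condition imposed for $j\ne i$ only, and $\mathbf m_i=0$. Corner map: $\zeta_{\mathbf m,j}(z,\hat z)=\hat z_j$ if $\mathbf m_j\ge\max(b_{ij},0)$, and $=z_j$ if $\mathbf m_j\le\min(a_{ij},0)$; in the CT case, $\zeta_{\mathbf m,i}(z,\hat z)=x_i$. Remainder functions: $\mathcal H_{\mathbf M_i}$ is the set of all ELLC $h:\mathcal Z\to\mathbb R$ with $[\underline J_C^h(z),\overline J_C^h(z)]\subseteq\mathbf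 M_i$ for all $z\in\mathcal Z$. Family: $f_{d,i}(z,\hat z;\mathbf m,h)=h(\zeta_{\mathbf m}(\hat z,z))+f_i(\zeta_{\mathbf m}(z,\hat z))-h(\zeta_{\mathbf m}(z,\hat z))$ for $\mathbf m\in\mathbf M_i$, $h\in\mathcal H_{\mathbf M_i}$. Upper/lower decomposition functions for $f_i$: mixed-monotone maps $\overline F,\underline F$ (nondecreasing in the first argument, in the CT case only with respect to changes leaving the $i$-th coordinate fixed, and nonincreasing in the second argument) such that $\underline z\le z\le\overline z$ implies $\underline F(\underline z,\overline z)\le f_i(z)\le\overline F(\overline z,\underline z)$ (in the CT case with $\underline z_i=z_i=\overline z_i=x_i$). Tractable: can be constructed in closed form, i.e. with a finite number of elementary operations and without differentiation or an iterative procedure. Inclusion function for $f_i$: an interval-valued map $T$ with $f_i(\mathbb I\mathcal Z)\subset T(\mathbb I\mathcal Z)$ for every interval $\mathbb I\mathcal Z$ in the domain (in the CT case with the $i$-th coordinate of $\mathbb I\mathcal Z$ fixed to $x_i$).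
   Formalization: The min/max ranges over pairs (m,h) where in each coordinate m_j and the Clarke derivatives of h lie on the same side defining M_i (with m, h independent it fails: f=0, a=-1, b=1, m=1, h=-Kz is unbounded); pairs z≥ẑ are taken with [ẑ,z] contained in Z. *)

(* Defs.v *)
From HB Require Import structures.
From mathcomp Require Import all_boot all_order all_algebra.
From mathcomp Require Import all_classical all_reals all_analysis.
Set Implicit Arguments.
Unset Strict Implicit.
Unset Printing Implicit Defensive.
Import Order.TTheory GRing.Theory Num.Theory.
Import numFieldNormedType.Exports.
Local Open Scope classical_set_scope.
Local Open Scope ring_scope.

Variant time_domain := DT | CT.

Section Vectors.
Context {R : realType} {n : nat}.
Implicit Types (x y z : 'rV[R]_n) (Z : set 'rV[R]_n).

Definition vle x y : Prop := forall j, x 0 j <= y 0 j.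

Definition box x y : set 'rV[R]_n := [set t | vle x t /\ vle t y].

(* The box spanned by two opposite corners, which need not be ordered. *)
Definition hull x y : set 'rV[R]_n :=
  box (\row_j Num.min (x 0 j) (y 0 j)) (\row_j Num.max (x 0 j) (y 0 j)).

(* Either-sided local Lipschitz continuity.  The matrix topology is that of
   R^n, so [ELLC Z phi] forces Z to be open.  The norm of matrices is the sup
   norm, hence the squared Euclidean norm is written out. *)
Definition ELLC Z (phi : 'rV[R]_n -> R) : Prop :=
  forall z, Z z ->
  exists (N : set 'rV[R]_n) (kappa : 'rV[R]_n) (rho : R),
    [/\ open N, N z, N `<=` Z, (forall j, kappa 0 j != 0) &
        forall z1 z2, N z1 -> N z2 ->
          \sum_j (kappa 0 j * (phi z1 - phi z2)) * (z1 0 j - z2 0 j)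
          <= rho * \sum_j (z1 0 j - z2 0 j) ^+ 2].

(* Directional difference quotient at p = (t, lambda). *)
Definition quotient_at (phi : 'rV[R]_n -> R) (j : 'I_n) (p : 'rV[R]_n * R) :
    \bar R :=
  ((phi (p.1 + p.2 *: 'e_j) - phi p.1) / p.2)%:E.

(* Clarke derivatives.  Functions are total, but when z lies in the open set
   Z only their values on Z matter here. *)
Definition clarke_upper (phi : 'rV[R]_n -> R) z (j : 'I_n) : \bar R :=
  limf_esup (quotient_at phi j) (filter_prod (nbhs z) (0^'+)).

Definition clarke_lower (phi : 'rV[R]_n -> R) z (j : 'I_n) : \bar R :=
  limf_einf (quotient_at phi j) (filter_prod (nbhs z) (0^'+)).

Definition clarke_bounds Z (phi : 'rV[R]_n -> R) (a b : 'I_n -> \bar R) :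
    Prop :=
  forall z, Z z -> forall j,
    (a j <= clarke_lower phi z j)%E /\ (clarke_upper phi z j <= b j)%E.

End Vectors.

Section Decomposition.
Context {R : realType} {n : nat}.
(* [i] is the coordinate of z carrying the i-th state; [a], [b] are the i-th
   rows of the bounds on the Clarke derivatives. *)
Variables (k : time_domain) (Z : set 'rV[R]_n) (i : 'I_n) (phi : 'rV[R]_n -> R).
Variables (a b : 'I_n -> \bar R).
Implicit Types (m z zh : 'rV[R]_n) (h : 'rV[R]_n -> R) (F : 'rV[R]_n -> 'rV[R]_n -> R).

(* In continuous time, x_i is frozen: comparisons leave it fixed, m_i = 0, and
   the corner map keeps the i-th coordinate of its first argument. *)
Definition held (j : 'I_n) : bool := if k is CT then j == i else false.

Definition above (j : 'I_n) (v : \bar R) : bool := (Order.max (b j) 0 <= v)%E.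
Definition below (j : 'I_n) (v : \bar R) : bool := (v <= Order.min (a j) 0)%E.

(* Membership in the set of supporting vectors, for extended real vectors:
   Clarke derivatives of remainder functions may be infinite. *)
Definition supporting (v : 'I_n -> \bar R) : Prop :=
  forall j, if held j then v j = 0%E else above j (v j) \/ below j (v j).

Definition Msupp : set 'rV[R]_n := [set m | supporting (fun j => (m 0 j)%:E)].

(* Only finite values of max(b_j, 0) and min(a_j, 0) give elements. *)
Definition Mcorner : set 'rV[R]_n :=
  [set m | forall j, if held j then m 0 j = 0 else
     (m 0 j)%:E = Order.max (b j) 0%E \/ (m 0 j)%:E = Order.min (a j) 0%E].

(* For m in Msupp, the two cases of the corner map overlap only if m_j = 0 and
   b_j <= 0 <= a_j; then phi does not depend on the j-th coordinate and the
   choice made here is immaterial. *)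
Definition zeta m z zh : 'rV[R]_n :=
  \row_j (if held j then z 0 j
          else if above j (m 0 j)%:E then zh 0 j else z 0 j).

Definition clarke_box h z : set ('I_n -> \bar R) :=
  [set v | forall j, (clarke_lower h z j <= v j <= clarke_upper h z j)%E].

Definition remainder_funs : set ('rV[R]_n -> R) :=
  [set h | ELLC Z h /\ forall z, Z z -> clarke_box h z `<=` supporting].

(* m supports h: in each coordinate, m_j and the Clarke derivatives of h lie
   on the same side, i.e. they select the same corner.  Without this link the
   remainder form is not a decomposition function: for n = 1, phi = 0, a = -1,
   b = 1, m = 1 and h = - K id (K >= 1) it is - K (z - zh). *)
Definition supports m h : Prop :=
  forall z, Z z -> forall v, clarke_box h z v -> forall j, ~~ held j ->
    (above j (m 0 j)%:E -> above j (v j)) /\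
    (below j (m 0 j)%:E -> below j (v j)).

Definition remainder_form m h z zh : R :=
  h (zeta m zh z) + phi (zeta m z zh) - h (zeta m z zh).

Definition remainder_values z zh : set R :=
  [set y | exists m h, [/\ Msupp m, remainder_funs h, supports m h &
                           y = remainder_form m h z zh]].

Definition corner_form m z zh : R :=
  phi (zeta m z zh) + \sum_j m 0 j * (zeta m zh z 0 j - zeta m z zh 0 j).

Definition corner_values z zh : set R :=
  [set corner_form m z zh | m in Mcorner].

Definition fd_upper z zh : R := inf (corner_values z zh).
Definition fd_lower z zh : R := sup (corner_values z zh).

(* The corner map takes its values in [hull z zh]; decomposition functions are
   considered on the pairs for which it is contained in the domain. *)
Definition mixed_monotone F : Prop :=
  (forall z z' zh, hull z zh `<=` Z -> hull z' zh `<=` Z ->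
     vle z z' -> (forall j, held j -> z 0 j = z' 0 j) -> F z zh <= F z' zh) /\
  (forall z zh zh', hull z zh `<=` Z -> hull z zh' `<=` Z ->
     vle zh zh' -> F z zh' <= F z zh).

Definition upper_decomposition F : Prop :=
  mixed_monotone F /\
  forall zl zu z, box zl zu `<=` Z -> box zl zu z ->
    (forall j, held j -> zl 0 j = zu 0 j) -> phi z <= F zu zl.

Definition lower_decomposition F : Prop :=
  mixed_monotone F /\
  forall zl zu z, box zl zu `<=` Z -> box zl zu z ->
    (forall j, held j -> zl 0 j = zu 0 j) -> F zl zu <= phi z.

Definition inclusion_function (T : 'rV[R]_n -> 'rV[R]_n -> interval R) : Prop :=
  forall zl zu, vle zl zu -> box zl zu `<=` Z ->
    (forall j, held j -> zl 0 j = zu 0 j) ->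
    phi @` box zl zu `<=` [set` T zl zu].

Definition remainder_inclusion zl zu : interval R :=
  `[fd_lower zl zu, fd_upper zu zl].

End Decomposition.

(* Closed-form expressions in the coordinates of two vectors: finitely many
   arithmetic operations, minima, maxima and evaluations of phi, with rational
   constants and the known bounds on the Clarke derivatives as the only data. *)
Inductive expr (n : nat) : Type :=
| Fst of 'I_n
| Snd of 'I_n
| Cst of rat
| LowerBd of 'I_n
| UpperBd of 'I_n
| Opp of expr n
| Add of expr n & expr n
| Mul of expr n & expr n
| Min of expr n & expr n
| Max of expr n & expr n
| Eval of ('I_n -> expr n).

Section Tractable.
Context {R : realType} {n : nat}.
Variables (Z : set 'rV[R]_n) (phi : 'rV[R]_n -> R) (a b : 'I_n -> \bar R).

Section Semantics.
Variables z zh : 'rV[R]_n.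

Fixpoint value (e : expr n) : R :=
  match e with
  | Fst j => z 0 j
  | Snd j => zh 0 j
  | Cst q => ratr q
  | LowerBd j => fine (a j)
  | UpperBd j => fine (b j)
  | Opp e => - value e
  | Add e1 e2 => value e1 + value e2
  | Mul e1 e2 => value e1 * value e2
  | Min e1 e2 => Num.min (value e1) (value e2)
  | Max e1 e2 => Num.max (value e1) (value e2)
  | Eval es => phi (\row_j value (es j))
  end.

(* Only finite bounds are used, and phi is only evaluated on its domain. *)
Fixpoint meaningful (e : expr n) : Prop :=
  match e with
  | Fst _ | Snd _ | Cst _ => True
  | LowerBd j => a j \is a fin_num
  | UpperBd j => b j \is a fin_num
  | Opp e => meaningful e
  | Add e1 e2 | Mul e1 e2 | Min e1 e2 | Max e1 e2 =>
      meaningful e1 /\ meaningful e2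
  | Eval es => (forall j, meaningful (es j)) /\ Z (\row_j value (es j))
  end.

End Semantics.

Definition tractable (F : 'rV[R]_n -> 'rV[R]_n -> R) : Prop :=
  exists e : expr n, forall z zh, hull z zh `<=` Z ->
    meaningful z zh e /\ value z zh e = F z zh.

End Tractable.

Definition is_min {R : realType} (S : set R) (x : R) : Prop :=
  S x /\ lbound S x.

Definition is_max {R : realType} (S : set R) (x : R) : Prop :=
  S x /\ ubound S x.

Definition state_disturbance {R : realType} {nx nw : nat}
    (X : set 'rV[R]_nx) (W : set 'rV[R]_nw) : set 'rV[R]_(nx + nw) :=
  [set z | X (lsubmx z) /\ W (rsubmx z)].

(* Main.v *)
(** Upper (lower) bounds on Clarke derivatives integrate along axis-parallel
    segments to bounds on increments, which makes every corner form mixed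
    monotone and equal to [phi] on the diagonal; this yields the decomposition
    and inclusion functions.  For tightness, a remainder function [h] supported
    by [m] grows between the two corners at least as much as the linear function
    whose slopes [max(b_j, 0)] or [min(a_j, 0)] are the extreme ones on the side
    of [m], and this linear function is itself an admissible remainder. *)

Require Import Defs.
From HB Require Import structures.
From mathcomp Require Import all_boot all_order all_algebra.
From mathcomp Require Import all_classical all_reals all_analysis.
From mathcomp Require Import lra.
Set Implicit Arguments.
Unset Strict Implicit.
Unset Printing Implicit Defensive.
Import Order.TTheory GRing.Theory Num.Theory.
Import numFieldNormedType.Exports.
Local Open Scope classical_set_scope.
Local Open Scope ring_scope.

(** * From Clarke derivative bounds to bounds on increments *)

Section Increments.
Context {R : realType} {n : nat}.
Implicit Types (phi : 'rV[R]_n -> R) (x y z w : 'rV[R]_n).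

Lemma clarke_lowerN phi z j :
  clarke_lower phi z j = (- clarke_upper (\- phi)%R z j)%E.
Proof.
rewrite /clarke_lower /clarke_upper /limf_einf; congr (- limf_esup _ _)%E.
apply/funext => p; rewrite /quotient_at /=; congr EFin.
by rewrite -mulNr opprB opprK addrC.
Qed.

(** Two sets of the proper product filter meet, and the quotient at a common point separates the
    infimum over one from the supremum over the other. This puts both end points into
    [clarke_box]. *)
Lemma clarke_lower_le_upper phi z j :
  (clarke_lower phi z j <= clarke_upper phi z j)%E.
Proof.
rewrite /clarke_lower /clarke_upper limf_einfE limf_esupE.
apply: ub_ereal_sup => _ [V FV <-]; apply: le_ereal_inf_tmp => _ [W FW <-].
have [p [Vp Wp]] : V `&` W !=set0.
  exact: (@filter_ex _ (filter_prod (nbhs z) 0^'+) _ _ (filterI FV FW)).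
apply: (@le_trans _ _ (quotient_at phi j p)).
  by apply: ereal_inf_lbound; exists p.
by apply: ereal_sup_ubound; exists p.
Qed.

(** A set of the product filter contains a product of a ball and a right neighborhood of 0, so one
    radius serves all base points [t] near [z] and all small steps [l]. *)
Lemma clarke_upper_near phi z j (c : R) : (clarke_upper phi z j < c%:E)%E ->
  exists2 d : R, 0 < d & forall t l, ball z d t -> 0 < l < d ->
    phi (t + l *: 'e_j) - phi t <= c * l.
Proof.
rewrite /clarke_upper limf_esupE => /ereal_inf_lt[_ [V FV <-] Vc].
have [[A B] /= [zA B0] ABV] := FV.
have [e1 /= e10 zA1] := (iffLR (nbhs_ballP _ _)) zA.
have [e2 /= e20 B2] := B0.
exists (Num.min e1 e2) => [|t l tz /andP[l0 le]]; first by rewrite lt_min e10.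
have Vtl : V (t, l).
  apply: ABV; split => /=.
    by apply: zA1; apply: le_ball tz; rewrite ge_min lexx.
  apply: B2 => //=; rewrite sub0r normrN gtr0_norm//.
  by apply: (lt_le_trans le); rewrite ge_min lexx orbT.
have : (quotient_at phi j (t, l) <= c%:E)%E.
  by apply: le_trans (ltW Vc); apply: ereal_sup_ubound; exists (t, l).
by rewrite lee_fin /= ler_pdivrMr.
Qed.

(** Real induction without continuity: the local estimate at [sup S] also holds at base points to
    its left, so a single step leads from a member of [S] past the supremum, unless [L] is reached
    first. *)
Lemma le_slope_of_local (g : R -> R) (L c : R) : 0 <= L ->
  (forall s, 0 <= s <= L -> exists2 d : R, 0 < d &
     forall t l, `|t - s| < d -> 0 < l < d -> g (t + l) - g t <= c * l) ->
  g L - g 0 <= c * L.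
Proof.
move=> L0 gc; pose S := [set s | 0 <= s <= L /\ g s - g 0 <= c * s].
have S0 : S 0 by split; rewrite ?lexx ?subrr ?mulr0.
have ubS : has_ubound S by exists L => s [/andP[]].
have supS : has_sup S by split => //; exists 0.
have s0 : 0 <= sup S by apply: ub_le_sup.
have sL : sup S <= L by apply: ge_sup => [|s [/andP[]]//]; exists 0.
have [|d d0 gd] := gc (sup S); first by rewrite s0.
have [s Ss sd] : exists2 s, S s & sup S - d / 4 < s.
  by apply: sup_adherent => //; lra.
have ss : s <= sup S by apply: ub_le_sup.
(* Since [s] exceeds [sup S - d / 4], the step [u - s] is below [3 d / 4], hence admissible for the
   radius [d]. *)
pose u := Num.min (sup S + d / 2) L.
have Su : S u.
  have [u1 u2] : u <= sup S + d / 2 /\ u <= L.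
    by rewrite !ge_min !lexx orbT.
  have su : s <= u by rewrite le_min; apply/andP; split; lra.
  case: Ss => [/andP[s1 s2] gs]; split; first by apply/andP; split; lra.
  move: su; rewrite le_eqVlt => /predU1P[<-//|su].
  have := gd s (u - s); rewrite subrKC ler0_norm ?subr_le0//.
  by move=> /(_ ltac:(lra)) /(_ ltac:(apply/andP; split; lra)); lra.
have us : u <= sup S by apply: ub_le_sup.
(* A member of [S] cannot exceed [sup S], so the minimum defining [u] is its cap [L]. *)
have uL : u = L by move: us; rewrite /u; case: (leP (sup S + d / 2) L) => ? ?; lra.
by rewrite -uL; case: Su.
Qed.

Lemma coordinate_increment_le phi x j (L c : R) : 0 <= L ->
  (forall s, 0 <= s <= L -> (clarke_upper phi (x + s *: 'e_j) j <= c%:E)%E) ->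
  phi (x + L *: 'e_j) - phi x <= c * L.
Proof.
move=> L0 phic; apply/ler_addgt0Pr => e e0.
have L1 : 0 < L + 1 by lra.
have ee0 : 0 < e / (L + 1) by rewrite divr_gt0.
have -> : phi x = phi (x + 0 *: 'e_j) by rewrite scale0r addr0.
(* [clarke_upper_near] needs a strict bound. The slack [e / (L + 1)] accumulates to at most [e] over
   length [L], and the [+ 1] covers [L = 0]. *)
apply: (@le_trans _ _ ((c + e / (L + 1)) * L)); last first.
  rewrite mulrDl lerD2l -mulrA ler_piMr ?(ltW e0)//.
  by rewrite mulrC ler_pdivrMr// mul1r; lra.
apply: (le_slope_of_local (g := fun s => phi (x + s *: 'e_j))) => // s sL.
have [|d d0 phid] := @clarke_upper_near phi (x + s *: 'e_j) j (c + e / (L + 1)).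
  by apply: (le_lt_trans (phic _ sL)); rewrite lte_fin ltrDl.
exists d => // t l ts ld; rewrite scalerDl addrA; apply: phid => //; split=> // i0 k.
rewrite /ball /= !mxE; case: (_ && _).
  by rewrite !mulr1 opprD addrACA subrr add0r distrC.
by rewrite !mulr0 subrr normr0.
Qed.

Lemma hull_sub x y x' y' : hull x y x' -> hull x y y' ->
  hull x' y' `<=` hull x y.
Proof.
move=> [x1 x2] [y1 y2] t [t1 t2]; split => j.
  by apply: le_trans (t1 j); rewrite [leRHS]mxE le_min x1 y1.
by apply: le_trans (t2 j) _; rewrite [leLHS]mxE ge_max x2 y2.
Qed.

Lemma hullP x y t : hull x y t <->
  forall j, Num.min (x 0 j) (y 0 j) <= t 0 j <= Num.max (x 0 j) (y 0 j).
Proof.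
split=> [[t1 t2] j|ht]; first by have := t1 j; have := t2 j; rewrite !mxE => -> ->.
by split=> j; rewrite mxE; case/andP: (ht j).
Qed.

Lemma hull_mem x y (t : 'rV[R]_n) :
  (forall j, t 0 j = x 0 j \/ t 0 j = y 0 j) -> hull x y t.
Proof.
move=> ht; apply/hullP => j; rewrite ge_min le_max.
by case: (ht j) => ->; rewrite lexx ?orbT.
Qed.

(* Changing one coordinate at a time reduces the claim to one variable.  No
   continuity of [phi] is needed: the Clarke derivative is a limit over moving
   base points, hence it bounds difference quotients uniformly near a point. *)
Lemma increment_le (Z : set 'rV[R]_n) phi x y w : hull x y `<=` Z ->
  (forall j, x 0 j < y 0 j ->
     forall t, Z t -> (clarke_upper phi t j <= (w 0 j)%:E)%E) ->
  (forall j, y 0 j < x 0 j ->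
     forall t, Z t -> ((w 0 j)%:E <= clarke_lower phi t j)%E) ->
  phi y - phi x <= \sum_j w 0 j * (y 0 j - x 0 j).
Proof.
(* Induction on the number of coordinates in which [x] and [y] differ; [x'] below corrects one of
   them. *)
have [N] := ubnP #|[set j | x 0 j != y 0 j]%SET|.
elim: N x => // N IH x xyN xyZ phiu phil.
have [[j xyj]|] := pselect (exists j, x 0 j != y 0 j); last first.
  move=> /forallNP xy; have -> : x = y.
    by apply/rowP => j; apply/eqP; have /negP/negPn := xy j.
  by rewrite subrr big1// => j _; rewrite subrr mulr0.
pose x' := x + (y 0 j - x 0 j) *: 'e_j.
have x'E l : x' 0 l = if l == j then y 0 l else x 0 l.
  rewrite !mxE eqxx /=; case: eqP => [->|_]; last by rewrite mulr0 addr0.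
  by rewrite mulr1 subrKC.
have x'j : x' 0 j = y 0 j by rewrite x'E eqxx.
have xx'Z : hull x x' `<=` Z.
  apply: subset_trans xyZ; apply: hull_sub; apply: hull_mem => l; first by left.
  by rewrite x'E; case: ifP; [right|left].
have step : phi x' - phi x <= w 0 j * (y 0 j - x 0 j).
  have seg s : Num.min 0 (y 0 j - x 0 j) <= s <= Num.max 0 (y 0 j - x 0 j) ->
      Z (x + s *: 'e_j).
    move=> hs; apply: xx'Z; apply/hullP => l; rewrite x'E !mxE eqxx /=.
    case: eqP => [->|_] /=; last by rewrite mulr0 addr0 ge_min le_max lexx.
    rewrite mulr1; move: hs; rewrite !ge_min !le_max => /andP[/orP s1 /orP s2].
    by apply/andP; split; apply/orP; lra.
  have [xy|yx|xy] := ltgtP (x 0 j) (y 0 j); last by rewrite xy eqxx in xyj.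
    apply: coordinate_increment_le => [|s /andP[s0 sL]]; first by lra.
    by apply: phiu => //; apply: seg; rewrite ge_min le_max s0 sL orbT.
  (* For a decreasing coordinate, the segment is traversed upwards from [x'] to [x] with [- phi] and
     slope [- w 0 j]; negation turns the lower Clarke bound into an upper one. *)
  pose psi := (\- phi).
  have -> : phi x' - phi x = psi (x' + (x 0 j - y 0 j) *: 'e_j) - psi x'.
    rewrite (_ : x' + _ = x) /psi /=; first by rewrite opprK addrC.
    by rewrite /x' -addrA -scalerDl addrC -opprB addNr scale0r add0r.
  have -> : w 0 j * (y 0 j - x 0 j) = - w 0 j * (x 0 j - y 0 j) by lra.
  apply: coordinate_increment_le => [|s /andP[s0 sL]]; first by lra.
  rewrite EFinN leeNr -clarke_lowerN; apply: phil => //.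
  rewrite /x' -addrA -scalerDl; apply: seg.
  rewrite ge_min le_max; apply/andP; split; apply/orP; [right|left]; lra.
have x'y l : x' 0 l != y 0 l -> x' 0 l = x 0 l /\ l != j.
  by rewrite x'E; case: (eqVneq l j) => // _; rewrite eqxx.
have : phi y - phi x' <= \sum_l w 0 l * (y 0 l - x' 0 l).
  apply: IH => [||l xl|l xl].
  - move: xyN; rewrite ltnS; apply: leq_trans; apply: proper_card; apply/properP; split.
      by apply/fintype.subsetP => l; rewrite !inE => /[dup] /x'y[->].
    by exists j; rewrite !inE ?x'j ?eqxx.
  - apply: subset_trans xyZ; apply: hull_sub; apply: hull_mem => l; last by right.
    by rewrite x'E; case: ifP; [right|left].
  - have [e _] : x' 0 l = x 0 l /\ l != j by apply: x'y; rewrite lt_eqF.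
    by apply: phiu; rewrite -e.
  - have [e _] : x' 0 l = x 0 l /\ l != j by apply: x'y; rewrite gt_eqF.
    by apply: phil; rewrite -e.
rewrite (bigD1 j)//= [in X in _ -> X](bigD1 j)//= x'j subrr mulr0 add0r.
rewrite (eq_bigr (fun l => w 0 l * (y 0 l - x 0 l))); first by lra.
by move=> l lj; rewrite x'E (negbTE lj).
Qed.

End Increments.

(** * Monotonicity of a single corner form *)

Section Corners.
Context {R : realType} {n : nat}.
Variables (k : time_domain) (Z : set 'rV[R]_n) (i : 'I_n) (phi : 'rV[R]_n -> R).
Variables (a b : 'I_n -> \bar R).
Hypothesis phiab : clarke_bounds Z phi a b.
Implicit Types (m x y z : 'rV[R]_n).

Local Notation zeta := (zeta k i b).
Local Notation corner_form := (corner_form k i phi b).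
Local Notation held := (held k i).
Local Notation Mcorner := (Mcorner k i a b).
Local Notation Msupp := (Msupp k i a b).

Lemma hullC x y : hull x y = hull y x.
Proof.
by rewrite /hull; congr box; apply/rowP => j; rewrite !mxE 1?minC 1?maxC.
Qed.

Lemma hull_ordered x y : vle x y -> hull x y = box x y.
Proof.
move=> xy; rewrite /hull; congr box; apply/rowP => j; rewrite !mxE.
  by rewrite min_l.
by rewrite max_r.
Qed.

Lemma hull_zeta x y m z zh : hull x y z -> hull x y zh -> hull x y (zeta m z zh).
Proof.
move=> /hullP xyz /hullP xyzh; apply/hullP => j; rewrite mxE.
by case: ifP => _ //; case: ifP.
Qed.

Lemma hull_zeta_id m z zh : hull z zh (zeta m z zh).
Proof. by apply: hull_zeta; apply: hull_mem => j; [left|right]. Qed.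

Lemma Mcorner_sub_Msupp : Mcorner `<=` Msupp.
Proof.
move=> m mc j; have := mc j; case: ifP => [_ -> //|_ [->|->]].
  by left; rewrite /above.
by right; rewrite /below.
Qed.

Lemma above_bound m j : above b j (m 0 j)%:E ->
  0 <= m 0 j /\ (b j <= (m 0 j)%:E)%E.
Proof. by rewrite /above ge_max lee_fin => /andP[]. Qed.

Lemma Msupp_below m j : Msupp m -> ~~ held j -> ~~ above b j (m 0 j)%:E ->
  m 0 j <= 0 /\ ((m 0 j)%:E <= a j)%E.
Proof.
move=> /(_ j) /[swap] /negbTE -> [->//|+ _].
by rewrite /below le_min lee_fin => /andP[].
Qed.

Lemma Msupp_held m j : Msupp m -> held j -> m 0 j = 0.
Proof. by move=> /(_ j) /[swap] -> []. Qed.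

(** The witness is the coordinatewise projection of [zh] onto the box from [z] to [z']. *)
Lemma clamp z z' zh : vle z z' -> exists c : 'rV[R]_n,
  [/\ vle z c, vle c z', hull z zh c & hull z' zh c].
Proof.
move=> zz'; exists (\row_j Num.max (z 0 j) (Num.min (z' 0 j) (zh 0 j))).
by split=> [j|j||]; [| |apply/hullP => j|apply/hullP => j]; rewrite !mxE; have := zz' j;
  rewrite /Order.max /Order.min => ?;
  case: (ltP (z' 0 j) (zh 0 j)); case: (ltP (z 0 j) (zh 0 j));
  case: (ltP (z 0 j) (z' 0 j)) => *; lra.
Qed.

(** Where [m] is [above], the argument of [phi] stays put and the linear term grows because
    [m 0 j >= 0]. Elsewhere the linear term loses [m 0 j * (z' 0 j - z 0 j)], and [phi] gains at
    least that much since [m 0 j <= a j]. *)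
Lemma corner_form_le_first_nested m z z' zh : Msupp m ->
  hull (zeta m z' zh) (zeta m z zh) `<=` Z -> vle z z' ->
  (forall j, held j -> z 0 j = z' 0 j) ->
  corner_form m z zh <= corner_form m z' zh.
Proof.
move=> mM sZ zz' zhz; rewrite /corner_form.
have := @increment_le _ _ Z phi (zeta m z' zh) (zeta m z zh) m sZ.
move=> /(_ _)/wrap[j|/(_ _)/wrap[j|le]].
- rewrite !mxE; case: ifP => [/zhz->|_]; first by rewrite ltxx.
  by case: ifP => _; rewrite ?ltxx// ltNge zz'.
- rewrite !mxE; case: ifP => [/zhz->|hj]; first by rewrite ltxx.
  case: ifPn => mj; rewrite ?ltxx// => _ t Zt.
  have [_ ma] := Msupp_below mM (negbT hj) mj.
  by apply: le_trans ma _; have [] := phiab Zt j.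
suff : \sum_j m 0 j * (zeta m z zh 0 j - zeta m z' zh 0 j) +
       \sum_j m 0 j * (zeta m zh z 0 j - zeta m z zh 0 j) <=
       \sum_j m 0 j * (zeta m zh z' 0 j - zeta m z' zh 0 j) by lra.
rewrite -big_split /=; apply: ler_sum => j _.
suff : 0 <= m 0 j * (zeta m zh z' 0 j - zeta m zh z 0 j) by lra.
rewrite !mxE; case: ifP => hj; first by rewrite subrr mulr0.
case: ifP => mj; last by rewrite subrr mulr0.
have [m0 _] := above_bound mj.
by rewrite mulr_ge0// subr_ge0 zz'.
Qed.

(** Here the roles swap: where [m] is [above], [phi] grows with slope at most [b j <= m 0 j], which
    the linear term cancels; elsewhere only the linear term moves, with [m 0 j <= 0]. A held
    coordinate of [zh] is harmless because [m 0 j = 0]. *)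
Lemma corner_form_le_second_nested m z zh zh' : Msupp m ->
  hull (zeta m z zh) (zeta m z zh') `<=` Z -> vle zh zh' ->
  corner_form m z zh' <= corner_form m z zh.
Proof.
move=> mM sZ zz'; rewrite /corner_form.
have := @increment_le _ _ Z phi (zeta m z zh) (zeta m z zh') m sZ.
move=> /(_ _)/wrap[j|/(_ _)/wrap[j|le]].
- rewrite !mxE; case: ifP => hj; first by rewrite ltxx.
  case: ifP => mj; rewrite ?ltxx// => _ t Zt.
  have [_] := above_bound mj.
  by apply: le_trans; have [] := phiab Zt j.
- rewrite !mxE; case: ifP => hj; first by rewrite ltxx.
  by case: ifP => _; rewrite ?ltxx// ltNge zz'.
suff : \sum_j m 0 j * (zeta m z zh' 0 j - zeta m z zh 0 j) +
       \sum_j m 0 j * (zeta m zh' z 0 j - zeta m z zh' 0 j) <=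
       \sum_j m 0 j * (zeta m zh z 0 j - zeta m z zh 0 j) by lra.
rewrite -big_split /=; apply: ler_sum => j _.
suff : 0 <= m 0 j * (zeta m zh z 0 j - zeta m zh' z 0 j) by lra.
rewrite !mxE; case: ifP => hj; first by rewrite (Msupp_held mM hj) mul0r.
case: ifPn => mj; first by rewrite subrr mulr0.
have [m0 _] := Msupp_below mM (negbT hj) mj.
by rewrite mulr_le0// subr_le0 zz'.
Qed.

(* The hulls of (z, zh) and (z', zh) need not be nested: the clamped point lies
   in both, so the comparison is made in two steps through it. *)
Lemma corner_form_le_first m z z' zh : Msupp m ->
  hull z zh `<=` Z -> hull z' zh `<=` Z -> vle z z' ->
  (forall j, held j -> z 0 j = z' 0 j) ->
  corner_form m z zh <= corner_form m z' zh.
Proof.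
move=> mM zZ z'Z zz' hz; have [c [zc cz' hc hc']] := clamp zh zz'.
have hcz j : held j -> c 0 j = z 0 j.
  by move=> hj; apply/eqP; rewrite eq_le zc (hz _ hj) cz'.
have right x y : hull x y y by apply: hull_mem => j; right.
apply: (@le_trans _ _ (corner_form m c zh)).
  apply: corner_form_le_first_nested => // [|j /hcz->//].
  by apply: subset_trans zZ; apply: hull_sub;
    [exact: hull_zeta|exact: hull_zeta_id].
apply: corner_form_le_first_nested => // [|j hj]; last by rewrite hcz// hz.
by apply: subset_trans z'Z; apply: hull_sub;
  [exact: hull_zeta_id|exact: hull_zeta].
Qed.

Lemma corner_form_le_second m z zh zh' : Msupp m ->
  hull z zh `<=` Z -> hull z zh' `<=` Z -> vle zh zh' ->
  corner_form m z zh' <= corner_form m z zh.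
Proof.
move=> mM zZ z'Z zz'; have [c [zc cz' hc hc']] := clamp z zz'.
rewrite hullC in hc; rewrite hullC in hc'.
have left x y : hull x y x by apply: hull_mem => j; left.
apply: (@le_trans _ _ (corner_form m z c)).
  apply: corner_form_le_second_nested => //.
  by apply: subset_trans z'Z; apply: hull_sub;
    [exact: hull_zeta|exact: hull_zeta_id].
apply: corner_form_le_second_nested => //.
by apply: subset_trans zZ; apply: hull_sub;
  [exact: hull_zeta_id|exact: hull_zeta].
Qed.

Lemma corner_form_diag m z : corner_form m z z = phi z.
Proof.
have zz : zeta m z z = z.
  by apply/rowP => j; rewrite mxE; case: ifP => _ //; case: ifP.
rewrite /corner_form zz big1 ?addr0// => j _.
by rewrite subrr mulr0.
Qed.

End Corners.

Lemma is_min_inf {R : realType} (S : set R) x : is_min S x -> inf S = x.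
Proof.
move=> [Sx lbS]; apply/eqP; rewrite eq_le; apply/andP; split.
  by apply: ge_inf => //; exists x.
by apply: lb_le_inf => //; exists x.
Qed.

Lemma is_max_sup {R : realType} (S : set R) x : is_max S x -> sup S = x.
Proof.
move=> [Sx ubS]; apply/eqP; rewrite eq_le; apply/andP; split.
  by apply: ge_sup => //; exists x.
by apply: ub_le_sup => //; exists x.
Qed.

(** * Finiteness of the corner vectors and attainment of the extrema *)

Section SignChoices.
Context {R : realType} {n : nat}.
Variables (k : time_domain) (i : 'I_n) (phi : 'rV[R]_n -> R).
Variables (a b : 'I_n -> \bar R).
Hypothesis ab : forall j, (b j < +oo)%E \/ (-oo < a j)%E.
Implicit Types (s : {ffun 'I_n -> bool}) (z zh : 'rV[R]_n).

Local Notation zeta := (zeta k i b).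
Local Notation corner_form := (corner_form k i phi b).
Local Notation held := (held k i).
Local Notation Mcorner := (Mcorner k i a b).

Definition sign_vector s : 'rV[R]_n :=
  \row_j (if held j then 0
          else fine (if s j then Order.max (b j) 0 else Order.min (a j) 0)%E).

(** These are the choices that select a finite value outside held coordinates, so that [fine] in
    [sign_vector] never falls back on its default. *)
Definition admissible s : bool :=
  [forall j, held j || (if s j then b j < +oo else -oo < a j)%E].

Definition default_choice : {ffun 'I_n -> bool} := [ffun j => (b j < +oo)%E].

Lemma default_admissible : admissible default_choice.
Proof.
apply/forallP => j; rewrite ffunE; case: ifPn => [->|]; first by rewrite orbT.
by case: (ab j) => [->//|->]; rewrite orbT.
Qed.

Lemma max0_fin_num (x : \bar R) : (x < +oo)%E -> Order.max x 0%E \is a fin_num.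
Proof.
by case: x => [r|//|] _; [rewrite -EFin_max|rewrite maxC maxeNy].
Qed.

Lemma min0_fin_num (x : \bar R) : (-oo < x)%E -> Order.min x 0%E \is a fin_num.
Proof.
by case: x => [r| |//] _; [rewrite -EFin_min|rewrite minC miney].
Qed.

Lemma sign_vector_corner s : admissible s -> Mcorner (sign_vector s).
Proof.
move=> /forallP sP j; rewrite mxE; have := sP j.
case: (held j) => //=.
by case: (s j) => [/max0_fin_num|/min0_fin_num] f; [left|right]; rewrite fineK.
Qed.

Lemma corner_sign_vector m : Mcorner m -> exists2 s, admissible s & m = sign_vector s.
Proof.
(* Ties between the two extreme values go to the maximum. The choice is admissible because the
   entries of [m] are real, which keeps the selected bound away from the bad infinity. *)
move=> mM; exists [ffun j => (m 0 j)%:E == Order.max (b j) 0%E].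
  apply/forallP => j; rewrite ffunE; have := mM j; case: ifP => //= _.
  case: eqP => [e _|_ [//|e]].
    by rewrite (@le_lt_trans _ _ (m 0 j)%:E) ?ltry// e le_max lexx.
  by rewrite (@lt_le_trans _ _ (m 0 j)%:E) ?ltNyr// e ge_min lexx.
apply/rowP => j; rewrite mxE ffunE; have := mM j; case: ifP => //= _.
by case: eqP => [<-//|_ [//|<-]].
Qed.

Lemma Mcorner_finite : finite_set Mcorner.
Proof.
apply: (@sub_finite_set _ _ (range sign_vector)).
  by move=> m /corner_sign_vector[s _ ->]; exists s.
by apply: finite_image; exact: finite_finset.
Qed.

Lemma Mcorner_nonempty : Mcorner !=set0.
Proof.
by exists (sign_vector default_choice); apply/sign_vector_corner/default_admissible.
Qed.

Local Notation form s z zh := (corner_form (sign_vector s) z zh).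

Lemma fd_upper_min z zh :
  is_min [set corner_form m z zh | m in Mcorner] (fd_upper k i phi a b z zh).
Proof.
have [s sP smin] := arg_minP (fun s => form s z zh) default_admissible.
suff sM : is_min [set corner_form m z zh | m in Mcorner] (form s z zh).
  by rewrite /fd_upper (is_min_inf sM).
split; first by exists (sign_vector s) => //; exact: sign_vector_corner.
by move=> _ [m /corner_sign_vector[s' s'P ->] <-]; exact: smin.
Qed.

Lemma fd_lower_max z zh :
  is_max [set corner_form m z zh | m in Mcorner] (fd_lower k i phi a b z zh).
Proof.
have [s sP smax] := arg_maxP (fun s => form s z zh) default_admissible.
suff sM : is_max [set corner_form m z zh | m in Mcorner] (form s z zh).
  by rewrite /fd_lower (is_max_sup sM).
split; first by exists (sign_vector s) => //; exact: sign_vector_corner.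
by move=> _ [m /corner_sign_vector[s' s'P ->] <-]; exact: smax.
Qed.

(** * Closed-form expressions for the extrema *)

Section Expressions.
Variable Z : set 'rV[R]_n.

Local Notation value := (value phi a b).
Local Notation meaningful := (meaningful Z phi a b).

(** Finiteness of the bounds is decided while the expression is built, so infinite bounds are never
    mentioned. For an admissible choice an infinite selected bound is [b j = -oo] or [a j = +oo],
    and the entry is then 0. *)
Definition sign_expr s (j : 'I_n) : expr n :=
  if held j then Cst n 0
  else if s j then
    if b j \is a fin_num then Max (UpperBd j) (Cst n 0) else Cst n 0
  else if a j \is a fin_num then Min (LowerBd j) (Cst n 0) else Cst n 0.

(** The case distinction of the corner map depends only on the supporting vector, so the expression
    needs no conditional. *)
Definition zeta_expr s (u v : 'I_n -> expr n) (j : 'I_n) : expr n :=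
  if held j then u j
  else if above b j (sign_vector s 0 j)%:E then v j else u j.

Definition form_expr s : expr n :=
  Add (Eval (zeta_expr s (@Fst n) (@Snd n)))
    (foldr (fun j e => Add (Mul (sign_expr s j)
        (Add (zeta_expr s (@Snd n) (@Fst n) j)
             (Opp (zeta_expr s (@Fst n) (@Snd n) j)))) e)
       (Cst n 0) (enum 'I_n)).

Lemma sign_exprP s j z zh : admissible s ->
  meaningful z zh (sign_expr s j) /\
  value z zh (sign_expr s j) = sign_vector s 0 j.
Proof.
move=> /forallP/(_ j); rewrite /sign_expr mxE; case: (held j) => [_|/=].
  by rewrite /= rmorph0.
case: (s j).
  case bj: (b j) => [r|//|] _ /=; rewrite ?rmorph0 ?bj.
    by rewrite -EFin_max.
  by rewrite maxC maxeNy.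
case aj: (a j) => [r||//] _ /=; rewrite ?rmorph0 ?aj.
  by rewrite -EFin_min.
by [].
Qed.

Lemma zeta_exprP s u v j z zh :
  meaningful z zh (u j) -> meaningful z zh (v j) ->
  meaningful z zh (zeta_expr s u v j) /\
  value z zh (zeta_expr s u v j) =
    zeta (sign_vector s) (\row_l value z zh (u l)) (\row_l value z zh (v l)) 0 j.
Proof.
move=> uj vj; rewrite /zeta_expr [in RHS]mxE; case: ifP => _; rewrite ?mxE//.
by case: ifP.
Qed.

Lemma form_exprP s z zh : admissible s -> hull z zh `<=` Z ->
  meaningful z zh (form_expr s) /\ value z zh (form_expr s) = form s z zh.
Proof.
move=> sP zZ; have zE : \row_l value z zh (Fst l) = z by apply/rowP => j; rewrite mxE.
have zhE : \row_l value z zh (Snd l) = zh by apply/rowP => j; rewrite mxE.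
have FS j := @zeta_exprP s (@Fst n) (@Snd n) j z zh I I.
have SF j := @zeta_exprP s (@Snd n) (@Fst n) j z zh I I.
rewrite zE zhE in FS SF.
have eval : \row_j value z zh (zeta_expr s (@Fst n) (@Snd n) j) =
            zeta (sign_vector s) z zh.
  by apply/rowP => j; rewrite mxE (FS j).2.
rewrite /Defs.corner_form /form_expr /= eval -big_enum /=.
(* The scalar product is generalized from [enum 'I_n] to any list, for induction. *)
suff : forall l : seq 'I_n, let e := foldr (fun j e => Add (Mul (sign_expr s j)
        (Add (zeta_expr s (@Snd n) (@Fst n) j)
             (Opp (zeta_expr s (@Fst n) (@Snd n) j)))) e) (Cst n 0) l in
    meaningful z zh e /\ value z zh e =
    \sum_(j <- l) sign_vector s 0 j *
      (zeta (sign_vector s) zh z 0 j - zeta (sign_vector s) z zh 0 j).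
  move=> /(_ (enum 'I_n))[em ->]; split => //; split => //; split.
    by move=> j; exact: (FS j).1.
  by apply: zZ; exact: hull_zeta_id.
elim=> [|j l [em ev]] /=; first by rewrite big_nil rmorph0.
have [sm sv] := sign_exprP j z zh sP.
rewrite big_cons sv (FS j).2 (SF j).2 ev.
by have [? _] := FS j; have [? _] := SF j.
Qed.

Lemma foldr_MinP (I : eqType) (E : I -> expr n) (s0 : I) (l : seq I) z zh :
  (forall t, t \in s0 :: l -> meaningful z zh (E t)) ->
  let e := foldr (fun t => Min (E t)) (E s0) l in
  meaningful z zh e /\
  is_min [set value z zh (E t) | t in [set` s0 :: l]] (value z zh e).
Proof.
elim: l => [|s l IH] mE /=.
  split; first by apply: mE; rewrite mem_head.
  split; first by exists s0; rewrite //= mem_head.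
  by move=> _ [s /= + <-]; rewrite inE => /eqP->.
have [|em [[s' s'l <-] eb]] := IH.
  by move=> t; rewrite inE => /predU1P[->|tl]; apply: mE; rewrite !inE ?tl ?eqxx ?orbT.
split; first by split=> //; apply: mE; rewrite !inE eqxx orbT.
split.
  case: leP => _; [exists s|exists s'] => //=; rewrite ?inE ?eqxx ?orbT//;
    by move: s'l; rewrite /= inE => /orP[]->; rewrite ?orbT.
move=> _ [t /= + <-]; rewrite !inE => /or3P[/eqP->|/eqP->|tl].
- by rewrite ge_min eb ?orbT//; exists s0; rewrite //= mem_head.
- by rewrite ge_min lexx ?orbT.
- by rewrite ge_min eb ?orbT//; exists t; rewrite //= inE tl orbT.
Qed.

Lemma foldr_MaxP (I : eqType) (E : I -> expr n) (s0 : I) (l : seq I) z zh :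
  (forall t, t \in s0 :: l -> meaningful z zh (E t)) ->
  let e := foldr (fun t => Max (E t)) (E s0) l in
  meaningful z zh e /\
  is_max [set value z zh (E t) | t in [set` s0 :: l]] (value z zh e).
Proof.
elim: l => [|s l IH] mE /=.
  split; first by apply: mE; rewrite mem_head.
  split; first by exists s0; rewrite //= mem_head.
  by move=> _ [s /= + <-]; rewrite inE => /eqP->.
have [|em [[s' s'l <-] eb]] := IH.
  by move=> t; rewrite inE => /predU1P[->|tl]; apply: mE; rewrite !inE ?tl ?eqxx ?orbT.
split; first by split=> //; apply: mE; rewrite !inE eqxx orbT.
split.
  case: leP => _; [exists s'|exists s] => //=; rewrite ?inE ?eqxx ?orbT//;
    by move: s'l; rewrite /= inE => /orP[]->; rewrite ?orbT.
move=> _ [t /= + <-]; rewrite !inE => /or3P[/eqP->|/eqP->|tl].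
- by rewrite le_max eb ?orbT//; exists s0; rewrite //= mem_head.
- by rewrite le_max lexx ?orbT.
- by rewrite le_max eb ?orbT//; exists t; rewrite //= inE tl orbT.
Qed.

(** The minimum is unfolded over the finitely many admissible choices; [default_choice] seeds the
    fold, since the syntax has no neutral element for [Min]. *)
Lemma fd_upper_tractable : tractable Z phi a b (fd_upper k i phi a b).
Proof.
pose l := [seq s <- enum {ffun 'I_n -> bool} | admissible s].
have lP s : s \in default_choice :: l -> admissible s.
  rewrite inE mem_filter => /predU1P[->|/andP[]//]; exact: default_admissible.
exists (foldr (fun s => Min (form_expr s)) (form_expr default_choice) l).
move=> z zh zZ.
have [s /lP sP|em [[s /lP sP <-] eb]] :=
  @foldr_MinP _ form_expr default_choice l z zh.
  exact: (form_exprP sP zZ).1.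
split=> //; apply/esym/is_min_inf; split.
  rewrite (form_exprP sP zZ).2; exists (sign_vector s) => //.
  exact: sign_vector_corner.
move=> _ [m /corner_sign_vector[t tP ->] <-]; rewrite -(form_exprP tP zZ).2.
by apply: eb; exists t; rewrite //= inE mem_filter tP mem_enum orbT.
Qed.

Lemma fd_lower_tractable : tractable Z phi a b (fd_lower k i phi a b).
Proof.
pose l := [seq s <- enum {ffun 'I_n -> bool} | admissible s].
have lP s : s \in default_choice :: l -> admissible s.
  rewrite inE mem_filter => /predU1P[->|/andP[]//]; exact: default_admissible.
exists (foldr (fun s => Max (form_expr s)) (form_expr default_choice) l).
move=> z zh zZ.
have [s /lP sP|em [[s /lP sP <-] eb]] :=
  @foldr_MaxP _ form_expr default_choice l z zh.
  exact: (form_exprP sP zZ).1.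
split=> //; apply/esym/is_max_sup; split.
  rewrite (form_exprP sP zZ).2; exists (sign_vector s) => //.
  exact: sign_vector_corner.
move=> _ [m /corner_sign_vector[t tP ->] <-]; rewrite -(form_exprP tP zZ).2.
by apply: eb; exists t; rewrite //= inE mem_filter tP mem_enum orbT.
Qed.

End Expressions.
End SignChoices.

(** * Remainder functions and tightness *)

Section Remainders.
Context {R : realType} {n : nat}.
Variables (k : time_domain) (Z : set 'rV[R]_n) (i : 'I_n) (phi : 'rV[R]_n -> R).
Variables (a b : 'I_n -> \bar R).
Implicit Types (m z zh : 'rV[R]_n) (h : 'rV[R]_n -> R).

Local Notation zeta := (zeta k i b).
Local Notation corner_form := (corner_form k i phi b).
Local Notation held := (held k i).
Local Notation Mcorner := (Mcorner k i a b).
Local Notation Msupp := (Msupp k i a b).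
Local Notation remainder_form := (remainder_form k i phi b).

Definition linear_form m z : R := \sum_j m 0 j * z 0 j.

Lemma linear_formB m z zh :
  linear_form m z - linear_form m zh = \sum_j m 0 j * (z 0 j - zh 0 j).
Proof. by rewrite -sumrB; apply: eq_bigr => j _; rewrite mulrBr. Qed.

Lemma clarke_upper_linear_le m z j :
  (clarke_upper (linear_form m) z j <= (m 0 j)%:E)%E.
Proof.
rewrite /clarke_upper limf_esupE.
(* On positive steps the quotient of a linear form is exactly its slope. *)
pose V : set ('rV[R]_n * R) := setT `*` [set l | 0 < l].
have FV : filter_prod (nbhs z) 0^'+ V.
  by exists (setT, [set l | 0 < l]) => //; split; [exact: filterT|exact: nbhs_right_gt].
apply: (@le_trans _ _ (ereal_sup (quotient_at (linear_form m) j @` V))).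
  by apply: ereal_inf_lbound; exists V.
apply: ub_ereal_sup => _ [[t l] [_ /= l0] <-]; rewrite lee_fin /= ler_pdivrMr//.
rewrite linear_formB (bigD1 j)//= big1 ?addr0 => [|j' j'j]; rewrite !mxE eqxx /=.
  by rewrite eqxx mulr1 addrAC subrr add0r.
by rewrite (negbTE j'j) mulr0 addr0 subrr mulr0.
Qed.

Lemma clarke_linear m z j : clarke_upper (linear_form m) z j = (m 0 j)%:E /\
  clarke_lower (linear_form m) z j = (m 0 j)%:E.
Proof.
have ule := clarke_upper_linear_le m z j.
have lge : ((m 0 j)%:E <= clarke_lower (linear_form m) z j)%E.
  rewrite clarke_lowerN leeNr.
  have -> : (\- linear_form m)%R = linear_form (- m).
    apply/funext => t /=; rewrite /linear_form -sumrN.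
    by apply: eq_bigr => l _; rewrite mxE mulNr.
  by apply: le_trans (clarke_upper_linear_le _ _ _) _; rewrite mxE.
have lu := clarke_lower_le_upper (linear_form m) z j.
by split; apply/le_anti; rewrite ?ule ?lge ?(le_trans lge lu) ?(le_trans lu ule).
Qed.

Lemma ELLC_linear m : ELLC Z phi -> ELLC Z (linear_form m).
Proof.
move=> phiE z Zz; have [N [_ [_ [oN Nz NZ _ _]]]] := phiE z Zz.
(* With all entries of [kappa] equal to 1, the left side is a sum of terms [m_l d_l d_j] with
   [d = x - y], and each product [d_l d_j] is at most the squared norm of [d] in absolute value. The
   neighborhood is borrowed from [phi]. *)
exists N, (const_mx 1), (n%:R * \sum_l `|m 0 l|); split=> // [j|x y _ _].
  by rewrite mxE oner_neq0.
set D := \sum_j (x 0 j - y 0 j) ^+ 2.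
have dD l : (x 0 l - y 0 l) ^+ 2 <= D.
  by rewrite /D (bigD1 l)//= lerDl sumr_ge0// => ? _; exact: sqr_ge0.
apply: (@le_trans _ _ (\sum_(j < n) (\sum_l `|m 0 l|) * D)); last first.
  by rewrite sumr_const card_ord -mulrA mulr_natl.
apply: ler_sum => j _; rewrite mxE mul1r linear_formB !mulr_suml.
apply: ler_sum => l _; rewrite -mulrA (le_trans (ler_norm _))// normrM.
rewrite ler_wpM2l// ler_norml.
have := dD l; have := dD j; move: (x 0 l - y 0 l) (x 0 j - y 0 j) => u v uD vD.
have := sqr_ge0 (u - v); have := sqr_ge0 (u + v); rewrite sqrrB sqrrD.
by move=> ? ?; apply/andP; split; lra.
Qed.

Lemma clarke_box_linear m z v :
  clarke_box (linear_form m) z v -> v = fun j => (m 0 j)%:E.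
Proof.
move=> vb; apply/funext => j; have := vb j.
by have [-> ->] := clarke_linear m z j => /le_anti.
Qed.

Lemma linear_remainder m : ELLC Z phi -> Msupp m ->
  remainder_funs k Z i a b (linear_form m).
Proof.
move=> phiE mM; split; first exact: ELLC_linear.
by move=> z _ v /clarke_box_linear->.
Qed.

Lemma linear_supports m : supports k Z i a b m (linear_form m).
Proof. by move=> z _ v /clarke_box_linear->. Qed.

Lemma remainder_form_linear m z zh :
  remainder_form m (linear_form m) z zh = corner_form m z zh.
Proof.
by rewrite /Defs.remainder_form /Defs.corner_form -linear_formB addrAC addrC.
Qed.

Hypothesis phiab : clarke_bounds Z phi a b.

(** Each entry of [m] is pulled toward 0 as far as its side allows. For [m] in [Msupp] the selected
    bound is finite, being compared with a real entry. *)
Definition corner_of m : 'rV[R]_n :=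
  \row_j (if held j then 0
          else fine (if above b j (m 0 j)%:E then Order.max (b j) 0
                     else Order.min (a j) 0)%E).

Lemma corner_ofE m j : Msupp m -> ~~ held j -> (corner_of m 0 j)%:E =
  (if above b j (m 0 j)%:E then Order.max (b j) 0 else Order.min (a j) 0)%E.
Proof.
move=> mM hj; rewrite mxE (negbTE hj).
case: ifPn => mj; rewrite fineK//.
  have [_ bm] := above_bound mj.
  by rewrite max0_fin_num// (le_lt_trans bm)// ltry.
have [_ ma] := Msupp_below mM hj mj.
by rewrite min0_fin_num// (lt_le_trans _ ma)// ltNyr.
Qed.

Lemma corner_of_corner m : Msupp m -> Mcorner (corner_of m).
Proof.
move=> mM j; case: ifPn => hj; first by rewrite mxE hj.
by rewrite corner_ofE//; case: ifP; [left|right].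
Qed.

(* [m] and [corner_of m] may choose different corners, but only along
   coordinates on which [phi] does not depend. *)
Lemma corner_of_differ m z zh j : Msupp m ->
  zeta (corner_of m) z zh 0 j != zeta m z zh 0 j ->
  [/\ corner_of m 0 j = 0, (b j <= 0)%E & (0 <= a j)%E].
Proof.
move=> mM; rewrite mxE [X in _ != X]mxE.
case: ifPn => [_|hj]; first by rewrite eqxx.
have := corner_ofE mM hj; case: ifPn => mj e.
  by rewrite e /above lexx eqxx.
case: ifPn => [|_]; last by rewrite eqxx.
rewrite /above ge_max => /andP[bc c0] _.
move: (c0) (bc); rewrite e le_min lexx andbT => a0 _.
have c00 : corner_of m 0 j = 0.
  by apply: EFin_inj; apply/le_anti; rewrite c0 e ge_min lexx orbT.
by split=> //; rewrite c00 in bc.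
Qed.

(** In every coordinate that changes, 0 bounds the Clarke derivatives from both sides, so
    [increment_le] with zero slopes applies from [x] to [y] and back. *)
Lemma eq_of_clarke0 x y : hull x y `<=` Z ->
  (forall j, x 0 j != y 0 j -> (b j <= 0)%E /\ (0 <= a j)%E) -> phi x = phi y.
Proof.
move=> + xyab; suff le x' y' : hull x' y' `<=` Z ->
    (forall j, x' 0 j != y' 0 j -> (b j <= 0)%E /\ (0 <= a j)%E) ->
    phi y' <= phi x'.
  move=> xyZ; apply/le_anti; rewrite !le//.
    by rewrite hullC.
  by move=> j; rewrite eq_sym; exact: xyab.
move=> xyZ ab0; rewrite -subr_le0.
apply: le_trans (increment_le (w := 0) xyZ _ _) _ => [j xy t Zt|j xy t Zt|].
- have [b0 _] := ab0 j (negbT (lt_eqF xy)); rewrite mxE (le_trans _ b0)//.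
  by have [] := phiab Zt j.
- have [_ a0] := ab0 j (negbT (gt_eqF xy)); rewrite mxE (le_trans a0)//.
  by have [] := phiab Zt j.
- by rewrite big1// => j _; rewrite mxE mul0r.
Qed.

(** This allows comparison with a remainder form of [m], which uses the corners of [m] itself. Where
    the corners disagree, the slope vanishes and [phi] is constant. *)
Lemma corner_form_corner_of m z zh : Msupp m -> hull z zh `<=` Z ->
  corner_form (corner_of m) z zh = phi (zeta m z zh) +
    \sum_j corner_of m 0 j * (zeta m zh z 0 j - zeta m z zh 0 j).
Proof.
move=> mM zZ; rewrite /Defs.corner_form; congr (_ + _).
  apply: eq_of_clarke0 => [|j /corner_of_differ[]//].
  by apply: subset_trans zZ; apply: hull_sub; exact: hull_zeta_id.
apply: eq_bigr => j _; have [->|] := eqVneq (corner_of m 0 j) 0.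
  by rewrite !mul0r.
move=> c0; congr (_ * (_ - _)); apply/eqP; apply: contraNT c0.
  by move=> /corner_of_differ[//|->].
by move=> /corner_of_differ[//|->].
Qed.

(** From [zeta m zh z] to [zeta m z zh], coordinates on the [above] side decrease and [h] has slope
    at least [max(b_j, 0)] there; the other free coordinates increase, with slope at most
    [min(a_j, 0)]. In held coordinates the slope of [h] is 0. *)
Lemma remainder_increment_le m h z zh : Msupp m -> remainder_funs k Z i a b h ->
  supports k Z i a b m h -> vle zh z -> hull z zh `<=` Z ->
  h (zeta m z zh) - h (zeta m zh z) <=
  \sum_j corner_of m 0 j * (zeta m z zh 0 j - zeta m zh z 0 j).
Proof.
move=> mM [_ hsupp] msupp zhz zZ.
(* The support conditions speak of members of the Clarke box; its end points are the members
   needed. *)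
have boxl t : clarke_box h t (clarke_lower h t).
  by move=> j; rewrite lexx clarke_lower_le_upper.
have boxu t : clarke_box h t (clarke_upper h t).
  by move=> j; rewrite lexx clarke_lower_le_upper.
apply: (@increment_le _ _ Z) => [|j|j].
- apply: subset_trans zZ; apply: hull_sub; last exact: hull_zeta_id.
  by rewrite hullC; exact: hull_zeta_id.
- rewrite !mxE => + t Zt; case: ifPn => hj.
    by move=> _; have := hsupp _ Zt _ (boxu t) j; rewrite hj => ->.
  case: ifPn => mj; first by rewrite ltNge zhz.
  move=> _; have := corner_ofE mM hj; rewrite mxE (negbTE hj) (negbTE mj) => ->.
  have [_] := msupp _ Zt _ (boxu t) _ hj; apply.
  by have := mM j; rewrite (negbTE hj) (negbTE mj) => -[].
- rewrite !mxE => + t Zt; case: ifPn => hj.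
    by move=> _; have := hsupp _ Zt _ (boxl t) j; rewrite hj => ->.
  case: ifPn => mj; last by rewrite ltNge zhz.
  move=> _; have := corner_ofE mM hj; rewrite mxE (negbTE hj) mj => ->.
  by have [+ _] := msupp _ Zt _ (boxl t) _ hj; apply.
Qed.

Lemma corner_form_le_remainder m h z zh :
  Msupp m -> remainder_funs k Z i a b h -> supports k Z i a b m h ->
  vle zh z -> hull z zh `<=` Z ->
  corner_form (corner_of m) z zh <= remainder_form m h z zh.
Proof.
move=> mM hR mh zhz zZ; rewrite corner_form_corner_of// /Defs.remainder_form.
have := remainder_increment_le mM hR mh zhz zZ.
suff -> : \sum_j corner_of m 0 j * (zeta m z zh 0 j - zeta m zh z 0 j) =
  - \sum_j corner_of m 0 j * (zeta m zh z 0 j - zeta m z zh 0 j) by lra.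
by rewrite -sumrN; apply: eq_bigr => j _; rewrite -mulrN opprB.
Qed.

Lemma remainder_le_corner_form m h z zh :
  Msupp m -> remainder_funs k Z i a b h -> supports k Z i a b m h ->
  vle zh z -> hull z zh `<=` Z ->
  remainder_form m h zh z <= corner_form (corner_of m) zh z.
Proof.
move=> mM hR mh zhz zZ; rewrite corner_form_corner_of//; last by rewrite hullC.
by have := remainder_increment_le mM hR mh zhz zZ; rewrite /Defs.remainder_form; lra.
Qed.

Hypothesis phiE : ELLC Z phi.
Hypothesis ab : forall j, (b j < +oo)%E \/ (-oo < a j)%E.

Local Notation fup := (fd_upper k i phi a b).
Local Notation flo := (fd_lower k i phi a b).

Lemma corner_form_remainder m z zh : Mcorner m ->
  remainder_values k Z i phi a b z zh (corner_form m z zh).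
Proof.
move=> /Mcorner_sub_Msupp mM; exists m, (linear_form m).
split=> //; [exact: linear_remainder|exact: linear_supports|].
by rewrite remainder_form_linear.
Qed.

Lemma fd_upper_tightest z zh : vle zh z -> box zh z `<=` Z ->
  is_min (remainder_values k Z i phi a b z zh) (fup z zh).
Proof.
move=> zhz zZ; rewrite -(hull_ordered zhz) hullC in zZ.
have [[m mM <-] lb] := fd_upper_min k i phi ab z zh.
split; first exact: corner_form_remainder.
move=> _ [m' [h [m'M hR mh ->]]].
apply: le_trans (corner_form_le_remainder m'M hR mh zhz zZ); apply: lb.
by exists (corner_of m') => //; exact: corner_of_corner.
Qed.

Lemma fd_lower_tightest z zh : vle zh z -> box zh z `<=` Z ->
  is_max (remainder_values k Z i phi a b zh z) (flo zh z).
Proof.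
move=> zhz zZ; rewrite -(hull_ordered zhz) hullC in zZ.
have [[m mM <-] ub] := fd_lower_max k i phi ab zh z.
split; first exact: corner_form_remainder.
move=> _ [m' [h [m'M hR mh ->]]].
apply: le_trans (remainder_le_corner_form m'M hR mh zhz zZ) _; apply: ub.
by exists (corner_of m') => //; exact: corner_of_corner.
Qed.

(** * Mixed monotonicity, decomposition and inclusion functions *)

Lemma fd_upper_mixed_monotone : mixed_monotone k Z i fup.
Proof.
split=> [z z' zh zZ z'Z zz' hz|z zh zh' zZ z'Z zz'].
  (* A minimizer for the pair with the larger value also competes in the minimum for the other
     pair. *)
  have [[m mM <-] _] := fd_upper_min k i phi ab z' zh.
  have [_ lb] := fd_upper_min k i phi ab z zh.
  apply: le_trans (corner_form_le_first phiab (Mcorner_sub_Msupp mM) zZ z'Z zz' hz).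
  by apply: lb; exists m.
have [[m mM <-] _] := fd_upper_min k i phi ab z zh.
have [_ lb] := fd_upper_min k i phi ab z zh'.
apply: le_trans (corner_form_le_second phiab (Mcorner_sub_Msupp mM) zZ z'Z zz').
by apply: lb; exists m.
Qed.

Lemma fd_lower_mixed_monotone : mixed_monotone k Z i flo.
Proof.
split=> [z z' zh zZ z'Z zz' hz|z zh zh' zZ z'Z zz'].
  (* For a maximum, the optimizer is taken at the pair with the smaller value. *)
  have [[m mM <-] _] := fd_lower_max k i phi ab z zh.
  have [_ ub] := fd_lower_max k i phi ab z' zh.
  apply: le_trans (corner_form_le_first phiab (Mcorner_sub_Msupp mM) zZ z'Z zz' hz) _.
  by apply: ub; exists m.
have [[m mM <-] _] := fd_lower_max k i phi ab z zh'.
have [_ ub] := fd_lower_max k i phi ab z zh.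
apply: le_trans (corner_form_le_second phiab (Mcorner_sub_Msupp mM) zZ z'Z zz') _.
by apply: ub; exists m.
Qed.

Lemma fd_upper_diag z : fup z z = phi z.
Proof.
by have [[m _ <-] _] := fd_upper_min k i phi ab z z; exact: corner_form_diag.
Qed.

Lemma fd_lower_diag z : flo z z = phi z.
Proof.
by have [[m _ <-] _] := fd_lower_max k i phi ab z z; exact: corner_form_diag.
Qed.

Lemma box_hulls zl zu z : box zl zu `<=` Z -> box zl zu z ->
  [/\ hull zu zl `<=` Z, hull z zl `<=` Z, hull zu z `<=` Z & hull z z `<=` Z].
Proof.
move=> bZ bz; have lu : vle zl zu.
  by move=> j; case: bz => /(_ j) + /(_ j); exact: le_trans.
rewrite -(hull_ordered lu) in bZ bz.
have hl : hull zl zu zl by apply: hull_mem => j; left.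
have hu : hull zl zu zu by apply: hull_mem => j; right.
by split; apply: subset_trans bZ; exact: hull_sub.
Qed.

Lemma held_box zl zu z j : box zl zu z -> zl 0 j = zu 0 j ->
  zl 0 j = z 0 j /\ z 0 j = zu 0 j.
Proof.
move=> [/(_ j) lz /(_ j) zu_ e]; split; apply/le_anti.
  by rewrite lz e.
by rewrite zu_ -e.
Qed.

(** The chain is [phi z = fup z z <= fup z zl <= fup zu zl]; in held coordinates the box is
    degenerate, as monotonicity in the first argument requires. *)
Lemma fd_upper_decomposition : upper_decomposition k Z i phi fup.
Proof.
split=> [|zl zu z bZ bz hlu]; first exact: fd_upper_mixed_monotone.
have [ul zl' uz zz] := box_hulls bZ bz; have [mono1 mono2] := fd_upper_mixed_monotone.
rewrite -fd_upper_diag; case: (bz) => lz zu'.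
apply: le_trans (mono2 _ _ _ zl' zz lz) _; apply: mono1 => // j /hlu.
by move=> /(held_box bz)[].
Qed.

Lemma fd_lower_decomposition : lower_decomposition k Z i phi flo.
Proof.
split=> [|zl zu z bZ bz hlu]; first exact: fd_lower_mixed_monotone.
have [ul zl' uz zz] := box_hulls bZ bz; have [mono1 mono2] := fd_lower_mixed_monotone.
rewrite -fd_lower_diag; case: (bz) => lz zu'.
rewrite hullC in ul; rewrite hullC in zl'; rewrite hullC in uz.
apply: le_trans (mono1 _ _ _ ul uz lz _) _; last exact: mono2.
by move=> j /hlu /(held_box bz)[].
Qed.

Lemma remainder_inclusion_function :
  inclusion_function k Z i phi (remainder_inclusion k i phi a b).
Proof.
move=> zl zu lu bZ hlu _ [z bz <-]; rewrite /remainder_inclusion /= in_itv /=.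
have [_ up] := fd_upper_decomposition; have [_ lo] := fd_lower_decomposition.
by rewrite up// lo.
Qed.

End Remainders.

Theorem theorem2 (R : realType) (nx nw : nat)
    (X : set 'rV[R]_nx) (W : set 'rV[R]_nw)
    (f : 'rV[R]_(nx + nw) -> 'rV[R]_nx) (k : time_domain) (i : 'I_nx)
    (a b : 'I_nx -> 'I_(nx + nw) -> \bar R) :
  let Z := state_disturbance X W in
  let c := lshift nw i in
  let fi := fun z => f z 0 i in
  let Mc := Mcorner k c (a i) (b i) in
  let fup := fd_upper k c fi (a i) (b i) in
  let flo := fd_lower k c fi (a i) (b i) in
  ELLC Z fi ->
  clarke_bounds Z fi (a i) (b i) ->
  (forall j, (b i j < +oo)%E \/ (-oo < a i j)%E) ->
  [/\ finite_set Mc /\ Mc !=set0,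
      forall z zh,
        is_min [set corner_form k c fi (b i) m z zh | m in Mc] (fup z zh) /\
        is_max [set corner_form k c fi (b i) m zh z | m in Mc] (flo zh z),
      upper_decomposition k Z c fi fup /\ lower_decomposition k Z c fi flo,
      tractable Z fi (a i) (b i) fup /\ tractable Z fi (a i) (b i) flo &
      (forall z zh, vle zh z -> box zh z `<=` Z ->
        is_min (remainder_values k Z c fi (a i) (b i) z zh) (fup z zh) /\
        is_max (remainder_values k Z c fi (a i) (b i) zh z) (flo zh z)) /\
      inclusion_function k Z c fi (remainder_inclusion k c fi (a i) (b i))].
Proof.
move=> Z c fi Mc fup flo fiE fiab ab; split.
- by split; [exact: Mcorner_finite|exact: Mcorner_nonempty].
- by move=> z zh; split; [exact: fd_upper_min|exact: fd_lower_max].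
- by split; [exact: fd_upper_decomposition|exact: fd_lower_decomposition].
- by split; [exact: fd_upper_tractable|exact: fd_lower_tractable].
- split; last exact: remainder_inclusion_function.
  by move=> z zh zhz bZ; split; [exact: fd_upper_tightest|exact: fd_lower_tightest].
Qed.
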